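(* Let $\mathfrak{L}$ be the generalized super $W$-algebra described in the context and let $\mathfrak{V}=\mathfrak{L}\otimes\mathfrak{L}$ with the adjoint diagonal action. Then $H^1(\mathfrak{L},\mathfrak{V})=0$. Equivalently, $\mathrm{Der}(\mathfrak{L},\mathfrak{V})=\mathrm{Inn}(\mathfrak{L},\mathfrak{V})$: every derivation from $\mathfrak{L}$ to $\mathfrak{V}$ is inner. This holds in both cases $s\in\Gamma$ and $s\notin\Gamma$ (with $2s\in\Gamma$).
   Context: Let $\Gamma$ be a nontrivial additive subgroup of $\mathbb{R}$, and let $s\in\mathbb{R}$ with $2s\in\Gamma$. The Lie superalgebra $\mathfrak{L}$ over $\mathbb{C}$ has basis $\{L_p,I_p,G_r,H_r\mid p\in\Gamma,\ r\in s+\Gamma\}$. Here $L_p,I_p$ are even and $G_r,H_r$ are odd. The nonzero super-brackets are $[L_p,L_q]=(p-q)L_{p+q}$, $[L_p,I_q]=(p-q)I_{p+q}$, $[L_p,G_r]=(\tfrac p2-r)G_{p+r}$, $[L_p,H_r]=(\tfrac p2-r)H_{p+r}$, $[G_r,G_t]=I_{r+t}$, $[I_p,G_r]=(p-2r)H_{p+r}$. All other brackets of basis elements vanish, apart from those forced by super-antisymmetry. For a homogeneous element $x$, $[x]\in\mathbb{Z}_2$ denotes its parity. Let $\mathfrak{V}=\mathfrak{L}\otimes\mathfrak{L}$ be the algebraic tensor product, with parity $[a\otimes b]=[a]+[b]$. $\mathfrak{L}$ acts on $\mathfrak{V}$ by the adjoint diagonal action $x\circ(a\otimes b)=[x,a]\otimes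 b+(-1)^{[x][a]}a\otimes[x,b]$. A linear map $d:\mathfrak{L}\to\mathfrak{V}$ is a homogeneous derivation of parity $[d]\in\mathbb{Z}_2$ if it shifts parity by $[d]$ and satisfies $d([x,y])=(-1)^{[d][x]}x\circ d(y)-(-1)^{[y]([d]+[x])}y\circ d(x)$ for all homogeneous $x,y$. $\mathrm{Der}(\mathfrak{L},\mathfrak{V})$ is the direct sum of the even and odd derivations. For homogeneous $a\in\mathfrak{V}$, the inner derivation $a_{\mathrm{Inn}}$ is $a_{\mathrm{Inn}}(x)=(-1)^{[a][x]}x\circ a$; this is extended linearly in $a$. $\mathrm{Inn}(\mathfrak{L},\mathfrak{V})$ is the space of all such maps, and $H^1(\mathfrak{L},\mathfrak{V})=\mathrm{Der}(\mathfrak{L},\mathfrak{V})/\mathrm{Inn}(\mathfrak{L},\mathfrak{V})$. *)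

(* Defs.v *)
From Stdlib Require Import Reals List.
Import ListNotations.
Open Scope R_scope.

Record C := mkC { Cre : R; Cim : R }.
Definition C0 : C := mkC 0 0.
Definition C1 : C := mkC 1 0.
Definition Cadd (z w : C) : C := mkC (Cre z + Cre w) (Cim z + Cim w).
Definition Cmul (z w : C) : C :=
  mkC (Cre z * Cre w - Cim z * Cim w) (Cre z * Cim w + Cim z * Cre w).
Definition Copp (z : C) : C := mkC (- Cre z) (- Cim z).
Definition RtoC (x : R) : C := mkC x 0.

(* sign (-1)^b for a parity b : bool (false = even, true = odd) *)
Definition sgn (b : bool) : C := if b then Copp C1 else C1.

(* basis vector (k, x) stands for L_x, I_x, G_x or H_x *)
Inductive kind := KL | KI | KG | KH.
Definition B : Type := (kind * R)%type.

Definition kind_eq_dec (k1 k2 : kind) : {k1 = k2} + {k1 <> k2}.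
Proof. decide equality. Defined.
Definition B_eq_dec (b1 b2 : B) : {b1 = b2} + {b1 <> b2}.
Proof. decide equality; [apply Req_dec_T | apply kind_eq_dec]. Defined.
Definition BB_eq_dec (p q : B * B) : {p = q} + {p <> q}.
Proof. decide equality; apply B_eq_dec. Defined.

Definition par (e : B) : bool :=
  match fst e with KL | KI => false | KG | KH => true end.

Definition validB (Gam : R -> Prop) (s : R) (e : B) : Prop :=
  match fst e with KL | KI => Gam (snd e) | KG | KH => Gam (snd e - s) end.

Definition is_subgroup (Gam : R -> Prop) : Prop :=
  Gam 0 /\ (forall x y, Gam x -> Gam y -> Gam (x + y)) /\ (forall x, Gam x -> Gam (- x)).

(* ---------- Elements of L: finite formal linear combinations ---------- *)
Definition Lvec : Type := list (C * B).
Definition lev (x : Lvec) (e : B) : C :=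
  fold_right (fun ce acc => if B_eq_dec (snd ce) e then Cadd (fst ce) acc else acc) C0 x.

(* Bracket of basis vectors (all nonzero brackets, with super-antisymmetry) *)
Definition br (e1 e2 : B) : Lvec :=
  let (k1, x) := e1 in let (k2, y) := e2 in
  match k1, k2 with
  | KL, KL => [(RtoC (x - y), (KL, x + y))]
  | KL, KI => [(RtoC (x - y), (KI, x + y))]
  | KI, KL => [(RtoC (- (y - x)), (KI, x + y))]
  | KL, KG => [(RtoC (x / 2 - y), (KG, x + y))]
  | KG, KL => [(RtoC (- (y / 2 - x)), (KG, x + y))]
  | KL, KH => [(RtoC (x / 2 - y), (KH, x + y))]
  | KH, KL => [(RtoC (- (y / 2 - x)), (KH, x + y))]
  | KG, KG => [(C1, (KI, x + y))]
  | KI, KG => [(RtoC (x - 2 * y), (KH, x + y))]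
  | KG, KI => [(RtoC (- (y - 2 * x)), (KH, x + y))]
  | _, _ => []
  end.

Definition lscale (c : C) (x : Lvec) : Lvec := map (fun ce => (Cmul c (fst ce), snd ce)) x.

Definition lbr (x y : Lvec) : Lvec :=
  flat_map (fun ce1 => flat_map (fun ce2 =>
    lscale (Cmul (fst ce1) (fst ce2)) (br (snd ce1) (snd ce2))) y) x.

(* ---------- Elements of V = L (x) L (basis: pairs of basis vectors) ---------- *)
Definition Vvec : Type := list (C * (B * B)).
Definition vev (v : Vvec) (p : B * B) : C :=
  fold_right (fun cp acc => if BB_eq_dec (snd cp) p then Cadd (fst cp) acc else acc) C0 v.
Definition veq (u v : Vvec) : Prop := forall p, vev u p = vev v p.
Definition vadd (u v : Vvec) : Vvec := u ++ v.
Definition vscale (c : C) (v : Vvec) : Vvec := map (fun cp => (Cmul c (fst cp), snd cp)) v.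

Definition actb (e a b : B) : Vvec :=
  map (fun ce => (fst ce, (snd ce, b))) (br e a) ++
  map (fun ce => (Cmul (sgn (par e && par a)) (fst ce), (a, snd ce))) (br e b).

Definition act (x : Lvec) (v : Vvec) : Vvec :=
  flat_map (fun ce => flat_map (fun cp =>
    vscale (Cmul (fst ce) (fst cp)) (actb (snd ce) (fst (snd cp)) (snd (snd cp)))) v) x.

Definition homL (Gam : R -> Prop) (s : R) (p : bool) (x : Lvec) : Prop :=
  forall e, lev x e <> C0 -> validB Gam s e /\ par e = p.
Definition validBB (Gam : R -> Prop) (s : R) (q : B * B) : Prop :=
  validB Gam s (fst q) /\ validB Gam s (snd q).
Definition parBB (q : B * B) : bool := xorb (par (fst q)) (par (snd q)).
Definition homV (Gam : R -> Prop) (s : R) (p : bool) (v : Vvec) : Prop :=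
  forall q, vev v q <> C0 -> validBB Gam s q /\ parBB q = p.

(* ---------- Linear maps L -> V, given by images of basis vectors ---------- *)
Definition dext (d : B -> Vvec) (x : Lvec) : Vvec :=
  flat_map (fun ce => vscale (fst ce) (d (snd ce))) x.

Definition isDer (Gam : R -> Prop) (s : R) (pd : bool) (d : B -> Vvec) : Prop :=
  (forall e, validB Gam s e -> homV Gam s (xorb (par e) pd) (d e)) /\
  (forall (x y : Lvec) (px py : bool), homL Gam s px x -> homL Gam s py y ->
     veq (dext d (lbr x y))
         (vadd (vscale (sgn (pd && px)) (act x (dext d y)))
               (vscale (Copp (sgn (py && xorb pd px))) (act y (dext d x))))).

Definition inn (pa : bool) (a : Vvec) (e : B) : Vvec :=
  vscale (sgn (pa && par e)) (act [(C1, e)] a).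

(* Main.v *)
(** Fix [g > 0] in [Gam]; the even part contains the Witt algebra spanned by the [L_p], and on each
    pair of kinds [(k1, k2)] the tensor square is a product of two density modules.

    Write [f_n(x, y)] for the coefficient of [d(L_{ng})] at [(k1, x), (k2, y)]. For [n >= 1] its support
    lies in a half plane [x >= -N], so for fixed [(x, y)] and large [n] the ray [F(n) = f_n(x, y + ng)]
    satisfies a closed cocycle equation. That equation forces [F(n) = (be n g - y) c(x, y)], and letting
    [n] go to infinity in the cocycle identity gives [f_n = L_{ng} c] for every [n], with [c] a priori
    of infinite support. Finite support of [f_0] confines [c] to the line [x + y = 0] up to finitely
    many points; there [f_1] and [f_2] give three linear equations on three consecutive values of [c],
    with a determinant that vanishes for at most one [x]. So [c] is an element of the tensor square.

    The difference of [d] and the inner derivation of [c] kills every [L_{ng}], hence commutes with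
    them, and a finitely supported vector whose [L_p]-translates behave like those of one basis vector
    must vanish. *)
From Stdlib Require Import Reals List Bool Lra Lia Psatz ClassicalEpsilon.
Require Import Defs.
Import ListNotations.
Open Scope R_scope.

(** * Cocycles on a Witt ray with values in products of density modules *)

(** Action of $L_p$ on coefficient functions over density modules of weights [al] and [be]. The
    coefficient at [x] comes from [x - p], so the structure constant $\alpha p-(x-p)$ appears as
    $(\alpha+1)p-x$. *)
Definition wact (al be p : R) (u : R -> R -> R) (x y : R) : R :=
  ((al + 1) * p - x) * u (x - p) y + ((be + 1) * p - y) * u x (y - p).

Definition wcocycle (al be g : R) (f : nat -> R -> R -> R) : Prop :=
  forall n m x y,
    (INR n * g - INR m * g) * f (n + m)%nat x y =
    wact al be (INR n * g) (f m) x y - wact al be (INR m * g) (f n) x y.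

Definition finsupp (u : R -> R -> R) : Prop :=
  exists l : list (R * R), forall x y, u x y <> 0 -> In (x, y) l.

Lemma finsupp_bound (u : R -> R -> R) :
  finsupp u -> exists N, forall x y, N < Rabs x -> u x y = 0.
Proof.
  intros [l Hl].
  assert (HN : exists N, forall q, In q l -> Rabs (fst q) <= N).
  { clear Hl. induction l as [|q l [N HN]].
    - exists 0. intros q [].
    - exists (Rmax (Rabs (fst q)) N). intros q' [<-|Hq'].
      + apply Rmax_l.
      + eapply Rle_trans; [apply HN, Hq' | apply Rmax_r]. }
  destruct HN as [N HN]. exists N. intros x y Hx.
  destruct (Req_dec_T (u x y) 0) as [E|E]; [exact E|].
  specialize (HN _ (Hl _ _ E)). simpl in HN. lra.
Qed.

Lemma multiples_unbounded (g K : R) :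
  0 < g -> exists n0, forall n, (n0 <= n)%nat -> K < INR n * g.
Proof.
  intros Hg. destruct (INR_unbounded (K / g)) as [n0 Hn0].
  exists n0. intros n Hn. apply le_INR in Hn.
  apply Rmult_lt_reg_r with (/ g); [now apply Rinv_0_lt_compat|].
  replace (INR n * g * / g) with (INR n) by (field; lra).
  unfold Rdiv in Hn0. lra.
Qed.

(** For [n >= 2] the cocycle identity expresses [f (n + 1)] through [f n] and [f 1], evaluated at
    [x] or further left. A lower bound for the supports of [f 1] and [f 2] therefore persists with
    the same [N]. *)
Lemma cocycle_low_support (al be g : R) (f : nat -> R -> R -> R) :
  0 < g -> wcocycle al be g f -> finsupp (f 1%nat) -> finsupp (f 2%nat) ->
  exists N, forall n x y, (1 <= n)%nat -> x < - N -> f n x y = 0.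
Proof.
  intros Hg Hf H1 H2.
  destruct (finsupp_bound _ H1) as [N1 HN1].
  destruct (finsupp_bound _ H2) as [N2 HN2].
  (* The [0] forces [x < - N] to be negative, so that [Rabs x] is [- x]. *)
  exists (Rmax 0 (Rmax N1 N2)).
  pose proof (Rmax_l 0 (Rmax N1 N2)). pose proof (Rmax_r 0 (Rmax N1 N2)).
  pose proof (Rmax_l N1 N2). pose proof (Rmax_r N1 N2).
  set (N := Rmax 0 (Rmax N1 N2)) in *.
  assert (B1 : forall x y, x < - N -> f 1%nat x y = 0).
  { intros x y Hx. apply HN1. rewrite Rabs_left; lra. }
  assert (B2 : forall x y, x < - N -> f 2%nat x y = 0).
  { intros x y Hx. apply HN2. rewrite Rabs_left; lra. }
  induction n as [|n IH]; intros x y Hn Hx; [lia|].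
  destruct n as [|[|n]]; [now apply B1 | now apply B2 |].
  specialize (Hf (S (S n)) 1%nat x y).
  replace (S (S n) + 1)%nat with (S (S (S n))) in Hf by lia.
  assert (P : 0 < INR (S (S n)) - 1).
  { rewrite !S_INR. pose proof (pos_INR n). lra. }
  unfold wact in Hf. rewrite INR_1 in Hf.
  assert (0 < INR (S (S n)) * g) by (apply Rmult_lt_0_compat; lra).
  rewrite (B1 (x - INR (S (S n)) * g)), (B1 x), (IH (x - 1 * g)), (IH x) in Hf by (lia || lra).
  assert (Q : (INR (S (S n)) - 1) * g <> 0) by nra.
  apply Rmult_eq_reg_l with ((INR (S (S n)) - 1) * g); [|exact Q]. lra.
Qed.

(** * The cocycle equation along a single ray *)

(* Degree-5 relation of the positive Witt algebra: [t, 4t] and [2t, 3t] both give F5.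
   The eliminant factors, with a quadratic form that is definite for be > 1/24. *)
Lemma ray_doubling (be t y F1 F2 F3 F4 F5 : R) :
  1 / 2 <= be -> 0 < t ->
  (t - 2 * t) * F3 = (be * t - 2 * t - y) * F2 - (be * (2 * t) - t - y) * F1 ->
  (t - 3 * t) * F4 = (be * t - 3 * t - y) * F3 - (be * (3 * t) - t - y) * F1 ->
  (t - 4 * t) * F5 = (be * t - 4 * t - y) * F4 - (be * (4 * t) - t - y) * F1 ->
  (2 * t - 3 * t) * F5 =
    (be * (2 * t) - 3 * t - y) * F3 - (be * (3 * t) - 2 * t - y) * F2 ->
  (be * t - y) * F2 = (be * (2 * t) - y) * F1.
Proof.
  intros Hb Ht H3 H4 H5 H5'.
  set (E := y * y - (2 * be - 3) * (y * t) + (be + 1) * (be + 2) * (t * t)).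
  assert (HE : E <> 0).
  { assert (4 * E = (2 * y - (2 * be - 3) * t) ^ 2 + (24 * be - 1) * (t * t))
      by (unfold E; ring).
    assert (0 < t * t) by nra.
    assert (0 < (24 * be - 1) * (t * t)) by nra.
    pose proof (pow2_ge_0 (2 * y - (2 * be - 3) * t)). lra. }
  assert (H : E * ((be * t - y) * F2 - (be * (2 * t) - y) * F1) = 0).
  (* Both sides of [K] are $-6t^3F_5$; the spare powers of [t] allow [F4] and then [F3] to be
     eliminated without division. *)
  { assert (K : (be * t - 4 * t - y) * (t * (2 * t * F4)) - 2 * t * (t * ((be * (4 * t) - t - y) * F1))
      = 6 * t * ( t * ((be * (2 * t) - 3 * t - y) * F3) - t * ((be * (3 * t) - 2 * t - y) * F2))) by nra.
    assert (K4 : 2 * t * F4 = (be * (3 * t) - t - y) * F1 - (be * t - 3 * t - y) * F3) by lra.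
    assert (K3 : t * F3 = (be * (2 * t) - t - y) * F1 - (be * t - 2 * t - y) * F2) by lra.
    rewrite K4 in K.
    replace (t * ((be * (3 * t) - t - y) * F1 - (be * t - 3 * t - y) * F3)) with
     ((be * (3 * t) - t - y) * (t * F1) - (be * t - 3 * t - y) * (t * F3)) in K by ring.
    replace (t * ((be * (2 * t) - 3 * t - y) * F3)) with
     ((be * (2 * t) - 3 * t - y) * (t * F3)) in K by ring.
    rewrite K3 in K. unfold E. lra. }
  apply Rmult_integral in H. destruct H; [contradiction | lra].
Qed.

(** Each [F n] determines all [F (m * n)]. Reading [F (n0 * n)] both as a multiple of [n] and as a
    multiple of [n0] then ties [F n] to [F n0]. The clause on [F n0 = 0] later keeps track of where
    [c] is supported. *)
Lemma ray_linear (be g y : R) (F : nat -> R) (n0 : nat) :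
  1 / 2 <= be -> 0 < g -> (1 <= n0)%nat ->
  (forall n, (n0 <= n)%nat -> 0 < be * (INR n * g) - y) ->
  (forall n m, (n0 <= n)%nat -> (n0 <= m)%nat ->
    (INR n * g - INR m * g) * F (n + m)%nat =
    (be * (INR n * g) - INR m * g - y) * F m -
    (be * (INR m * g) - INR n * g - y) * F n) ->
  exists c, (F n0 = 0 -> c = 0) /\
    forall n, (n0 <= n)%nat -> F n = (be * (INR n * g) - y) * c.
Proof.
  intros Hb Hg Hn0 Hpos HF.
  assert (Hmul : forall n, (n0 <= n)%nat -> forall m, (1 <= m)%nat ->
    (be * (INR n * g) - y) * F (m * n)%nat = (be * (INR m * (INR n * g)) - y) * F n).
  { intros n Hn.
    assert (Ht : 0 < INR n * g).
    { apply Rmult_lt_0_compat; [apply lt_0_INR; lia | exact Hg]. }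
    assert (HF' : forall a b, (1 <= a)%nat -> (1 <= b)%nat ->
      (INR a * (INR n * g) - INR b * (INR n * g)) * F ((a + b) * n)%nat =
      (be * (INR a * (INR n * g)) - INR b * (INR n * g) - y) * F (b * n)%nat -
      (be * (INR b * (INR n * g)) - INR a * (INR n * g) - y) * F (a * n)%nat).
    { intros a b Ha Hb'. specialize (HF (a * n)%nat (b * n)%nat).
      rewrite <- Nat.mul_add_distr_r, !mult_INR in HF.
      rewrite !Rmult_assoc in *. apply HF; nia. }
    (* The relation for equal indices reads [0 = 0], so the case [m = 2] has to come from degree 5;
       larger [m] follow from the pairs [(1, m - 1)]. *)
    assert (D : (be * (INR n * g) - y) * F (2 * n)%nat
              = (be * (2 * (INR n * g)) - y) * F (1 * n)%nat).
    { apply ray_doubling with (F3 := F (3 * n)%nat) (F4 := F (4 * n)%nat) (F5 := F (5 * n)%nat);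
        [exact Hb | exact Ht | | | |].
      - generalize (HF' 1%nat 2%nat ltac:(lia) ltac:(lia)). simpl INR. simpl Nat.add. intros Q; nra.
      - generalize (HF' 1%nat 3%nat ltac:(lia) ltac:(lia)). simpl INR. simpl Nat.add. intros Q; nra.
      - generalize (HF' 1%nat 4%nat ltac:(lia) ltac:(lia)). simpl INR. simpl Nat.add. intros Q; nra.
      - generalize (HF' 2%nat 3%nat ltac:(lia) ltac:(lia)). simpl INR. simpl Nat.add. intros Q; nra. }
    rewrite Nat.mul_1_l in D.
    induction m as [|m IH]; intros Hm; [lia|].
    destruct m as [|[|m]].
    - rewrite Nat.mul_1_l. simpl INR. ring_simplify. reflexivity.
    - simpl INR. exact D.
    - specialize (IH ltac:(lia)).
      assert (Q := HF' 1%nat (S (S m)) ltac:(lia) ltac:(lia)).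
      rewrite Nat.mul_1_l in Q. change (1 + S (S m))%nat with (S (S (S m))) in Q.
      rewrite INR_1 in Q. rewrite (S_INR (S (S m))).
      assert (P : 0 < INR (S (S m)) - 1).
      { rewrite !S_INR. pose proof (pos_INR m). lra. }
      set (k := INR (S (S m))) in *. set (t := INR n * g) in *.
      set (A := F (S (S m) * n)%nat) in *. set (X := F (S (S (S m)) * n)%nat) in *.
      apply Rmult_eq_reg_l with ((1 - k) * t); [|nra].
      replace ((1 - k) * t * ((be * t - y) * X)) with ((be * t - y) * ((1 * t - k * t) * X)) by ring.
      rewrite Q.
      replace ((be * t - y) * ((be * (1 * t) - k * t - y) * A - (be * (k * t) - 1 * t - y) * F n))
        with ((be * (1 * t) - k * t - y) * ((be * t - y) * A) - (be * t - y) * ((be * (k * t) - 1 * t - y) * F n)) by ring.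
      rewrite IH. ring. }
  pose proof (Hpos n0 (le_n _)) as P0.
  exists (F n0 / (be * (INR n0 * g) - y)). split.
  { intros ->. unfold Rdiv. ring. }
  intros n Hn.
  assert (A := Hmul n Hn n0 Hn0). assert (B := Hmul n0 (le_n _) n ltac:(lia)).
  rewrite (Nat.mul_comm n n0) in B.
  pose proof (Hpos (n * n0)%nat ltac:(nia)) as P. rewrite mult_INR in P.
  apply Rmult_eq_reg_l with (be * (INR n0 * (INR n * g)) - y); [|nra].
  rewrite <- A. apply Rmult_eq_reg_l with (be * (INR n0 * g) - y); [|lra].
  replace (be * (INR n * (INR n0 * g)) - y) with (be * (INR n0 * (INR n * g)) - y) in B by ring.
  replace ((be * (INR n0 * g) - y) * ((be * (INR n * g) - y) * F (n0 * n)%nat)) with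
    ((be * (INR n * g) - y) * ((be * (INR n0 * g) - y) * F (n0 * n)%nat)) by ring.
  rewrite B. field. lra.
Qed.

(** Once $ng > x+N$, the point $x-ng$ lies to the left of all supports. The terms of the first
    tensor factor drop out, which leaves a relation along the second factor alone. *)
Lemma cocycle_ray (al be g : R) (f : nat -> R -> R -> R) (x y : R) :
  1 / 2 <= be -> 0 < g -> wcocycle al be g f -> finsupp (f 1%nat) -> finsupp (f 2%nat) ->
  exists c,
    (c <> 0 -> exists n, f n x (y + INR n * g) <> 0) /\
    exists n0, forall n, (n0 <= n)%nat ->
      f n x (y + INR n * g) = (be * (INR n * g) - y) * c.
Proof.
  intros Hb Hg Hf H1 H2.
  destruct (cocycle_low_support al be g f Hg Hf H1 H2) as [N HN].
  destruct (multiples_unbounded g (x + N) Hg) as [n1 Hn1].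
  (* Since [be >= 1/2], this bound gives $\beta ng > y$. *)
  destruct (multiples_unbounded g (2 * Rabs y) Hg) as [n2 Hn2].
  set (n0 := S (n1 + n2)).
  destruct (ray_linear be g y (fun n => f n x (y + INR n * g)) n0) as [c [Hc0 Hc]];
    [exact Hb | exact Hg | unfold n0; lia | | |].
  - intros n Hn. specialize (Hn2 n ltac:(unfold n0 in Hn; lia)).
    pose proof (Rle_abs y). pose proof (Rabs_pos y). nra.
  - intros n m Hn Hm.
    assert (En := Hn1 n ltac:(unfold n0 in Hn; lia)).
    assert (Em := Hn1 m ltac:(unfold n0 in Hm; lia)).
    assert (Q := Hf n m x (y + INR (n + m) * g)). cbv beta in *.
    rewrite Q. unfold wact. rewrite plus_INR.
    rewrite (HN m (x - INR n * g)), (HN n (x - INR m * g)) by (lra || (unfold n0 in *; lia)).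
    replace (y + (INR n + INR m) * g - INR n * g) with (y + INR m * g) by ring.
    replace (y + (INR n + INR m) * g - INR m * g) with (y + INR n * g) by ring.
    ring.
  - exists c. split; [|exists n0; exact Hc].
    intros Hne. exists n0. intros E. apply Hne, Hc0, E.
Qed.

(** * From cocycles to coboundaries of finite support *)

(** [c] is chosen point by point from the rays. In the cocycle identity for [(n, m)] at
    [(x, y + INR n * g)] with [n] large, the values of [f n] and [f (n + m)] are known through [c];
    what remains is [f m x y] with the nonzero factor [be * p - y]. *)
Lemma cocycle_coboundary_formal (al be g : R) (f : nat -> R -> R -> R) :
  1 / 2 <= be -> 0 < g -> wcocycle al be g f -> (forall n, finsupp (f n)) ->
  exists c : R -> R -> R,
    (forall x y, c x y <> 0 -> exists n, f n x (y + INR n * g) <> 0) /\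
    (forall n x y, f n x y = wact al be (INR n * g) c x y).
Proof.
  intros Hb Hg Hf Hfin.
  pose (c := fun x y => proj1_sig (constructive_indefinite_description _
    (cocycle_ray al be g f x y Hb Hg Hf (Hfin 1%nat) (Hfin 2%nat)))).
  assert (Hc : forall x y, (c x y <> 0 -> exists n, f n x (y + INR n * g) <> 0) /\
    exists n0, forall n, (n0 <= n)%nat ->
      f n x (y + INR n * g) = (be * (INR n * g) - y) * c x y).
  { intros x y. unfold c. apply proj2_sig. }
  exists c. split; [intros x y; apply Hc|].
  intros m x y. set (q := INR m * g).
  (* Two rays enter: the one of [(x, y - q)], at both [n] and [n + m], and the one of
     [(x - q, y)]. *)
  destruct (proj2 (Hc x (y - q))) as [n1 E1].
  destruct (proj2 (Hc (x - q) y)) as [n2 E2].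
  destruct (finsupp_bound _ (Hfin m)) as [N HN].
  destruct (multiples_unbounded g (Rabs x + Rabs N) Hg) as [n3 Hn3].
  destruct (multiples_unbounded g (2 * Rabs y) Hg) as [n4 Hn4].
  set (n := (n1 + n2 + n3 + n4)%nat).
  specialize (E2 n ltac:(unfold n; lia)).
  assert (E3 := E1 (n + m)%nat ltac:(unfold n; lia)).
  specialize (E1 n ltac:(unfold n; lia)).
  specialize (Hn3 n ltac:(unfold n; lia)). specialize (Hn4 n ltac:(unfold n; lia)).
  assert (Q := Hf n m x (y + INR n * g)).
  rewrite plus_INR in E3. fold q in Q.
  replace ((INR n + INR m) * g) with (INR n * g + q) in E3 by (unfold q; ring).
  set (p := INR n * g) in *.
  replace (y - q + (p + q)) with (y + p) in E3 by ring.
  unfold wact in Q. replace (y + p - p) with y in Q by ring.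
  replace (y - q + p) with (y + p - q) in E1 by ring.
  rewrite (HN (x - p)), E1, E2, E3 in Q.
  2:{ pose proof (Rle_abs x). pose proof (Rle_abs N). pose proof (Rabs_pos N).
      rewrite Rabs_left; lra. }
  apply Rmult_eq_reg_l with (be * p - y).
  - unfold wact. lra.
  - pose proof (Rle_abs y). pose proof (Rabs_pos y). nra.
Qed.

Lemma coboundary_finsupp (al be g : R) (c : R -> R -> R) :
  1 / 2 <= al -> 1 / 2 <= be -> 0 < g ->
  (forall n, finsupp (wact al be (INR n * g) c)) -> finsupp c.
Proof.
  intros Ha Hb Hg Hfin.
  destruct (Hfin 0%nat) as [l0 H0]. destruct (Hfin 1%nat) as [l1 H1].
  destruct (Hfin 2%nat) as [l2 H2]. simpl INR in *.
  (* The zero in [x] of the determinant below. If [al = be] this quotient is a junk value, but then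
     the determinant has no zero. *)
  set (xr := - (2 * al * (be + 1) * g) / (al - be)).
  (* The first four lists hold the points where one of the four equations used can fail, each
     support being shifted back to [(x, y)]; the last is the exceptional point. *)
  exists (l0 ++ map (fun q => (fst q - g, snd q)) l1
     ++ map (fun q => (fst q - 2 * g, snd q + g)) l1
     ++ map (fun q => (fst q - 2 * g, snd q)) l2 ++ [(xr, - xr)]).
  intros x y Hc. rewrite !in_app_iff.
  destruct (Req_dec_T (wact al be (0 * g) c x y) 0) as [Z0|Z0]; [|left; now apply H0].
  destruct (Req_dec_T (wact al be (1 * g) c (x + g) y) 0) as [Z1|Z1].
  2:{ right; left. apply in_map_iff. exists (x + g, y). split; [|now apply H1].
      simpl. f_equal; ring. }
  destruct (Req_dec_T (wact al be (1 * g) c (x + 2 * g) (y - g)) 0) as [Z2|Z2].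
  2:{ right; right; left. apply in_map_iff. exists (x + 2 * g, y - g).
      split; [|now apply H1]. simpl. f_equal; ring. }
  destruct (Req_dec_T (wact al be ((1 + 1) * g) c (x + 2 * g) y) 0) as [Z3|Z3].
  2:{ right; right; right; left. apply in_map_iff. exists (x + 2 * g, y).
      split; [|now apply H2]. simpl. f_equal; ring. }
  right; right; right; right. left.
  unfold wact in Z0, Z1, Z2, Z3.
  replace (x - 0 * g) with x in Z0 by ring. replace (y - 0 * g) with y in Z0 by ring.
  assert (Ey : (x + y) * c x y = 0) by lra.
  apply Rmult_integral in Ey. destruct Ey as [Ey|Ey]; [|contradiction].
  assert (y = - x) by lra. subst y. clear Z0 Ey.
  replace (x + g - 1 * g) with x in Z1 by ring.
  replace (- x - 1 * g) with (- x - g) in Z1 by ring.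
  replace (x + 2 * g - 1 * g) with (x + g) in Z2 by ring.
  replace (- x - g - 1 * g) with (- x - 2 * g) in Z2 by ring.
  replace (x + 2 * g - (1 + 1) * g) with x in Z3 by ring.
  replace (- x - (1 + 1) * g) with (- x - 2 * g) in Z3 by ring.
  set (u0 := c x (- x)) in *. set (u1 := c (x + g) (- x - g)) in *.
  set (u2 := c (x + 2 * g) (- x - 2 * g)) in *.
  (* Cofactors of the [u0] column eliminate [u1] and [u2]; what multiplies [u0] is the factored
     determinant. *)
  assert (D : (al + be + 1) * (g * g) * ((al - be) * x + 2 * al * (be + 1) * g) * u0 = 0).
  { assert (Y1 : (al * g - x) * u0 + ((be + 1) * g + x) * u1 = 0) by lra.
    assert (Y2 : (al * g - x - g) * u1 + ((be + 2) * g + x) * u2 = 0) by lra.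
    assert (Y3 : (2 * al * g - x) * u0 + ((2 * be + 2) * g + x) * u2 = 0) by lra.
    transitivity ((al * g - x - g) * ((2 * be + 2) * g + x) * ((al * g - x) * u0 + ((be + 1) * g + x) * u1)
      - ((be + 1) * g + x) * ((2 * be + 2) * g + x) * ((al * g - x - g) * u1 + ((be + 2) * g + x) * u2)
      + ((be + 1) * g + x) * ((be + 2) * g + x) * ((2 * al * g - x) * u0 + ((2 * be + 2) * g + x) * u2)).
    - ring.
    - rewrite Y1, Y2, Y3. ring. }
  apply Rmult_integral in D. destruct D as [D|D]; [|contradiction].
  apply Rmult_integral in D. destruct D as [D|D]; [exfalso; nra|].
  assert (Hne : al - be <> 0).
  { intros E. rewrite E in D. nra. }
  assert (x = xr).
  { unfold xr. apply Rmult_eq_reg_l with (al - be); [|exact Hne].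
    replace ((al - be) * (- (2 * al * (be + 1) * g) / (al - be)))
      with (- (2 * al * (be + 1) * g)) by (field; exact Hne). lra. }
  now subst x.
Qed.

Lemma cocycle_coboundary (al be g : R) (f : nat -> R -> R -> R) :
  1 / 2 <= al -> 1 / 2 <= be -> 0 < g -> wcocycle al be g f -> (forall n, finsupp (f n)) ->
  exists c : R -> R -> R,
    finsupp c /\
    (forall x y, c x y <> 0 -> exists n, f n x (y + INR n * g) <> 0) /\
    (forall n x y, f n x y = wact al be (INR n * g) c x y).
Proof.
  intros Ha Hb Hg Hf Hfin.
  destruct (cocycle_coboundary_formal al be g f Hb Hg Hf Hfin) as [c [Hv Hc]].
  exists c. split; [|now split].
  apply coboundary_finsupp with al be g; [exact Ha | exact Hb | exact Hg |].
  intros n. destruct (Hfin n) as [l Hl]. exists l. intros x y. rewrite <- Hc. apply Hl.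
Qed.

(** * Vanishing of equivariant maps of finite support *)

(* [wact p (wact q w)] has a cross term at [(x + p, y + q)] that no multiple of
   [wact (p + q) w] can match when p, q, q - p are large. *)
Lemma equivariant_vanish (ka al be g r : R) (w : nat -> R -> R -> R) :
  1 / 2 <= ka -> 1 / 2 <= al -> 1 / 2 <= be -> 0 < g -> finsupp (w 0%nat) ->
  (forall n m x y,
    (ka * (INR m * g) - (r + INR n * g)) * w (n + m)%nat x y =
    wact al be (INR m * g) (w n) x y) ->
  forall x y, w 0%nat x y = 0.
Proof.
  intros Hk Ha Hb Hg Hfin Hw x y.
  destruct (finsupp_bound _ Hfin) as [N HN].
  pose proof (Rabs_pos x). pose proof (Rabs_pos y). pose proof (Rabs_pos r).
  pose proof (Rabs_pos N). pose proof (Rle_abs x). pose proof (Rle_abs y).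
  pose proof (Rle_abs r). pose proof (Rle_abs N). pose proof (Rle_abs (- x)) as Hx.
  rewrite Rabs_Ropp in Hx.
  set (M := 2 * Rabs x + 2 * Rabs y + 2 * Rabs r + 2 * Rabs N).
  destruct (multiples_unbounded g M Hg) as [n Hn]. specialize (Hn n (le_n _)).
  (* [q] must exceed [p] by [M], so that [x + p - q] leaves the support as well. *)
  destruct (multiples_unbounded g (INR n * g + M) Hg) as [m Hm]. specialize (Hm m (le_n _)).
  set (p := INR n * g) in *. set (q := INR m * g) in *. unfold M in *.
  (* [E3] and [E1'] annihilate two terms of [E2], which leaves [w m x (y + q) = 0]; [E1] carries
     this back to [w 0 x y]. *)
  assert (E1 := Hw 0%nat m x (y + q)). assert (E1' := Hw 0%nat m (x + p) (y + q - p)).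
  assert (E2 := Hw m n (x + p) (y + q)). assert (E3 := Hw 0%nat (m + n)%nat (x + p) (y + q)).
  rewrite plus_INR in E3. rewrite Nat.add_0_l in E1, E1', E3.
  replace ((INR m + INR n) * g) with (q + p) in E3 by (unfold p, q; ring).
  fold p q in E1, E1', E2. simpl INR in *.
  unfold wact in E1, E1', E2, E3.
  rewrite (HN (x + p - (q + p))) in E3 by (rewrite Rabs_left; lra).
  rewrite (HN (x + p)) in E3 by (rewrite Rabs_right; lra).
  rewrite (HN (x + p - q)) in E1' by (rewrite Rabs_left; lra).
  rewrite (HN (x + p)) in E1' by (rewrite Rabs_right; lra).
  rewrite (HN (x - q)) in E1 by (rewrite Rabs_left; lra).
  replace (x + p - p) with x in E2 by ring.
  replace (y + q - q) with y in E1 by ring.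
  assert (Z3 : w (m + n)%nat (x + p) (y + q) = 0).
  { apply Rmult_eq_reg_l with (ka * (q + p) - (r + 0 * g)); [lra | nra]. }
  assert (Z1 : w m (x + p) (y + q - p) = 0).
  { apply Rmult_eq_reg_l with (ka * q - (r + 0 * g)); [lra | nra]. }
  rewrite Z3, Z1 in E2.
  assert (Z2 : w m x (y + q) = 0).
  { apply Rmult_eq_reg_l with ((al + 1) * p - (x + p)); [lra | nra]. }
  rewrite Z2 in E1. apply Rmult_eq_reg_l with ((be + 1) * q - (y + q)); [lra | nra].
Qed.

(** * Complex scalars and functionals on formal sums *)

Lemma C_eq (z w : C) : Cre z = Cre w -> Cim z = Cim w -> z = w.
Proof. destruct z, w; simpl; intros -> ->; reflexivity. Qed.

Lemma C_ring_theory :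
  ring_theory C0 C1 Cadd Cmul (fun z w => Cadd z (Copp w)) Copp eq.
Proof. constructor; intros; apply C_eq; simpl; ring. Qed.

Add Ring C_ring : C_ring_theory.

Lemma C_eq_dec (z w : C) : {z = w} + {z <> w}.
Proof. decide equality; apply Req_dec_T. Qed.

(** Pairing with an arbitrary function on basis pairs. It turns identities between lists into linear
    identities in [phi]; [vev] is the case of [delta]. *)
Definition ev (phi : B * B -> C) (v : Vvec) : C :=
  fold_right (fun cp acc => Cadd (Cmul (fst cp) (phi (snd cp))) acc) C0 v.

Definition delta (p q : B * B) : C := if BB_eq_dec q p then C1 else C0.

Lemma vev_ev (v : Vvec) (p : B * B) : vev v p = ev (delta p) v.
Proof.
  induction v as [|cp v IH]; simpl; [reflexivity|].
  fold (vev v p). rewrite IH.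
  change (delta p (snd cp)) with (if BB_eq_dec (snd cp) p then C1 else C0).
  destruct (BB_eq_dec (snd cp) p); ring.
Qed.

Lemma ev_app (phi : B * B -> C) (u v : Vvec) : ev phi (u ++ v) = Cadd (ev phi u) (ev phi v).
Proof. induction u as [|cp u IH]; simpl; [ring | rewrite IH; ring]. Qed.

Lemma ev_vscale (phi : B * B -> C) (c : C) (v : Vvec) :
  ev phi (vscale c v) = Cmul c (ev phi v).
Proof. induction v as [|cp v IH]; simpl; [ring | rewrite IH; ring]. Qed.

Lemma ev_ext (phi psi : B * B -> C) (v : Vvec) :
  (forall q, phi q = psi q) -> ev phi v = ev psi v.
Proof. intros E. induction v as [|cp v IH]; simpl; [reflexivity | rewrite IH, E; reflexivity]. Qed.

Lemma ev_lin (c1 c2 : C) (phi1 phi2 : B * B -> C) (v : Vvec) :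
  ev (fun q => Cadd (Cmul c1 (phi1 q)) (Cmul c2 (phi2 q))) v =
  Cadd (Cmul c1 (ev phi1 v)) (Cmul c2 (ev phi2 v)).
Proof. induction v as [|cp v IH]; simpl; [ring | rewrite IH; ring]. Qed.

Definition vremove (p : B * B) (v : Vvec) : Vvec :=
  filter (fun cp => if BB_eq_dec (snd cp) p then false else true) v.

Lemma ev_vremove (phi : B * B -> C) (p : B * B) (v : Vvec) :
  ev phi v = Cadd (Cmul (vev v p) (phi p)) (ev phi (vremove p v)).
Proof.
  induction v as [|cp v IH]; simpl; [ring|]. fold (vev v p). rewrite IH.
  destruct (BB_eq_dec (snd cp) p) as [<-|]; simpl; ring.
Qed.

Lemma vev_vremove (p q : B * B) (v : Vvec) :
  vev (vremove p v) q = if BB_eq_dec q p then C0 else vev v q.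
Proof.
  induction v as [|cp v IH]; simpl.
  - destruct (BB_eq_dec q p); reflexivity.
  - destruct (BB_eq_dec (snd cp) p) as [E|E]; simpl; fold (vev (vremove p v) q);
      fold (vev v q); rewrite IH; destruct (BB_eq_dec q p), (BB_eq_dec (snd cp) q);
      congruence.
Qed.

(** Terms of a list may repeat and cancel, so the induction deletes all occurrences of the leading
    pair at once and runs on a length bound. *)
Lemma ev_null (phi : B * B -> C) (n : nat) :
  forall v, (length v <= n)%nat -> (forall q, vev v q = C0) -> ev phi v = C0.
Proof.
  induction n as [|n IH]; intros [|cp v] Hl Hv; simpl in Hl; try reflexivity; [lia|].
  rewrite ev_vremove with (p := snd cp), Hv, IH; [ring | |].
  - simpl. destruct (BB_eq_dec (snd cp) (snd cp)); [|congruence].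
    pose proof (filter_length_le (fun cp0 => if BB_eq_dec (snd cp0) (snd cp) then false else true) v).
    unfold vremove in *. lia.
  - intros q. rewrite vev_vremove, Hv. destruct (BB_eq_dec q (snd cp)); reflexivity.
Qed.

Lemma ev_veq (phi : B * B -> C) (u v : Vvec) : veq u v -> ev phi u = ev phi v.
Proof.
  intros E.
  assert (Z : ev phi (u ++ vscale (Copp C1) v) = C0).
  { apply ev_null with (n := length (u ++ vscale (Copp C1) v)); [lia|].
    intros q. rewrite vev_ev, ev_app, ev_vscale, <- !vev_ev, (E q). ring. }
  rewrite ev_app, ev_vscale in Z.
  transitivity (Cadd (Cadd (ev phi u) (Cmul (Copp C1) (ev phi v))) (ev phi v)); [ring|].
  rewrite Z. ring.
Qed.

Lemma vev_support (v : Vvec) (p : B * B) : vev v p <> C0 -> In p (map snd v).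
Proof.
  induction v as [|cp v IH]; simpl; [congruence|]. fold (vev v p).
  destruct (BB_eq_dec (snd cp) p); [now left | right; now apply IH].
Qed.

Lemma vvec_of_function (F : B * B -> C) (l : list (B * B)) :
  (forall q, F q <> C0 -> In q l) -> exists v, forall q, vev v q = F q.
Proof.
  (* [nodup] makes each value count once. *)
  intros HF. exists (map (fun q => (F q, q)) (nodup BB_eq_dec l)). intros q.
  assert (K : forall m, NoDup m ->
    vev (map (fun q => (F q, q)) m) q = if in_dec BB_eq_dec q m then F q else C0).
  { induction m as [|q' m IH]; intros Hm; [reflexivity|]. inversion_clear Hm.
    change (vev (map (fun q => (F q, q)) (q' :: m)) q) with
      (if BB_eq_dec q' q then Cadd (F q') (vev (map (fun q => (F q, q)) m) q)
       else vev (map (fun q => (F q, q)) m) q).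
    rewrite IH by assumption.
    destruct (BB_eq_dec q' q) as [->|Hne], (in_dec BB_eq_dec q m) as [i|i],
      (in_dec BB_eq_dec q (_ :: m)) as [j|j]; simpl in j;
      try contradiction; try tauto; ring. }
  rewrite K by apply NoDup_nodup.
  destruct (in_dec BB_eq_dec q (nodup BB_eq_dec l)) as [i|i]; [reflexivity|].
  destruct (C_eq_dec (F q) C0) as [E|E]; [now rewrite E|].
  exfalso. apply i, nodup_In, HF, E.
Qed.

(** * The action of basis vectors and its transpose *)

Definition act1 (e : B) (v : Vvec) : Vvec := act [(C1, e)] v.

(* Every bracket of basis vectors is [cof e1 e2] times the basis vector [mul e1 e2];
   the latter is junk when the bracket vanishes. *)
Definition cof (e1 e2 : B) : C := match br e1 e2 with [] => C0 | ce :: _ => fst ce end.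
Definition mul (e1 e2 : B) : B := match br e1 e2 with [] => e1 | ce :: _ => snd ce end.

(** Transpose of the action of [e], acting on functionals, with the Koszul sign in the second
    slot. *)
Definition tact (e : B) (phi : B * B -> C) (q : B * B) : C :=
  Cadd (Cmul (cof e (fst q)) (phi (mul e (fst q), snd q)))
       (Cmul (Cmul (sgn (par e && par (fst q))) (cof e (snd q))) (phi (fst q, mul e (snd q)))).

Lemma ev_actb (phi : B * B -> C) (e a b : B) : ev phi (actb e a b) = tact e phi (a, b).
Proof.
  unfold actb, tact, cof, mul. simpl. rewrite ev_app.
  destruct e as [k x], a as [k1 x1], b as [k2 x2], k, k1, k2; simpl; ring.
Qed.

Lemma ev_act1 (phi : B * B -> C) (e : B) (v : Vvec) : ev phi (act1 e v) = ev (tact e phi) v.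
Proof.
  unfold act1, act. simpl. rewrite app_nil_r.
  induction v as [|[c [a b]] v IH]; simpl; [reflexivity|].
  rewrite ev_app, ev_vscale, ev_actb, IH. simpl. ring.
Qed.

Lemma act1_veq (e : B) (u v : Vvec) : veq u v -> veq (act1 e u) (act1 e v).
Proof. intros E p. rewrite !vev_ev, !ev_act1. now apply ev_veq. Qed.

(** Density weight: $[L_p,X_r]=(\kappa p-r)X_{p+r}$ holds uniformly for the four kinds. *)
Definition kap (k : kind) : R := match k with KL | KI => 1 | KG | KH => 1 / 2 end.

Lemma kap_ge (k : kind) : 1 / 2 <= kap k.
Proof. destruct k; simpl; lra. Qed.

Lemma cof_L (p : R) (k : kind) (x : R) : cof (KL, p) (k, x) = RtoC (kap k * p - x).
Proof. destruct k; unfold cof; simpl; f_equal; field. Qed.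

Lemma mul_L (p : R) (k : kind) (x : R) : mul (KL, p) (k, x) = (k, p + x).
Proof. destruct k; reflexivity. Qed.

(** The Jacobi identity $[L_p,[X_r,b]]=[X_r,[L_p,b]]+[[L_p,X_r],b]$ paired with [psi], free of signs
    because $L_p$ is even. Junk values of [mul] come with a zero [cof]. *)
Lemma jacobi_L (psi : B -> C) (p : R) (k : kind) (r : R) (b : B) :
  Cmul (Cmul (cof (k, r) b) (cof (KL, p) (mul (k, r) b))) (psi (mul (KL, p) (mul (k, r) b))) =
  Cadd (Cmul (Cmul (cof (KL, p) b) (cof (k, r) (mul (KL, p) b)))
             (psi (mul (k, r) (mul (KL, p) b))))
       (Cmul (Cmul (RtoC (kap k * p - r)) (cof (k, p + r) b)) (psi (mul (k, p + r) b))).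
Proof.
  destruct b as [k' x].
  assert (E1 : r + (p + x) = p + r + x) by ring.
  assert (E2 : p + (r + x) = p + r + x) by ring.
  destruct k, k'; unfold cof, mul; simpl; rewrite ?E1, ?E2;
    apply C_eq; simpl; field.
Qed.

Lemma par_mul_L (p : R) (b : B) : par (mul (KL, p) b) = par b.
Proof. destruct b as [k x], k; reflexivity. Qed.

(** Each slot contributes a Jacobi identity and the mixed terms agree. Transposition reverses the
    order of the two actions; the factor [C1] gives the shape that [ev_lin] expects. *)
Lemma tact_jacobi_L (phi : B * B -> C) (p : R) (k : kind) (r : R) (q : B * B) :
  tact (k, r) (tact (KL, p) phi) q =
  Cadd (Cmul C1 (tact (KL, p) (tact (k, r) phi) q))
       (Cmul (RtoC (kap k * p - r)) (tact (k, p + r) phi q)).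
Proof.
  destruct q as [a b]. unfold tact. simpl fst; simpl snd.
  assert (Ja := jacobi_L (fun a => phi (a, b)) p k r a). cbv beta in Ja.
  assert (Jb := jacobi_L (fun b => phi (a, b)) p k r b). cbv beta in Jb.
  rewrite par_mul_L.
  replace (par (k, p + r)) with (par (k, r)) by (destruct k; reflexivity).
  change (par (KL, p)) with false. simpl andb.
  change (sgn false) with C1.
  set (s := sgn (par (k, r) && par a)).
  transitivity (Cadd (Cmul (Cmul (cof (k, r) a) (cof (KL, p) (mul (k, r) a)))
      (phi (mul (KL, p) (mul (k, r) a), b)))
    (Cadd (Cmul s (Cmul (Cmul (cof (k, r) b) (cof (KL, p) (mul (k, r) b)))
      (phi (a, mul (KL, p) (mul (k, r) b)))))
     (Cadd (Cmul (Cmul (cof (k, r) a) (cof (KL, p) b)) (phi (mul (k, r) a, mul (KL, p) b)))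
       (Cmul s (Cmul (Cmul (cof (k, r) b) (cof (KL, p) a)) (phi (mul (KL, p) a, mul (k, r) b))))))); [ring|].
  rewrite Ja, Jb. ring.
Qed.

Lemma act1_jacobi_L (phi : B * B -> C) (p : R) (k : kind) (r : R) (a : Vvec) :
  ev phi (act1 (KL, p) (act1 (k, r) a)) =
  Cadd (ev phi (act1 (k, r) (act1 (KL, p) a)))
       (Cmul (RtoC (kap k * p - r)) (ev phi (act1 (k, p + r) a))).
Proof.
  rewrite !ev_act1.
  rewrite (ev_ext _ _ a (fun q => tact_jacobi_L phi p k r q)), ev_lin. ring.
Qed.

(** Moves the shift by [p] from the basis vector to the tested point. Where the delta is nonzero,
    $x'=x-p$, which produces the coefficient of [wact]. *)
Lemma delta_shift1 (p : R) (k1 k2 k1' k2' : kind) (x y x' y' : R) :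
  Cmul (RtoC (kap k1' * p - x')) (delta ((k1, x), (k2, y)) ((k1', p + x'), (k2', y'))) =
  Cmul (RtoC ((kap k1 + 1) * p - x)) (delta ((k1, x - p), (k2, y)) ((k1', x'), (k2', y'))).
Proof.
  unfold delta.
  destruct (BB_eq_dec (k1', p + x', (k2', y')) (k1, x, (k2, y))) as [E|E],
    (BB_eq_dec (k1', x', (k2', y')) (k1, x - p, (k2, y))) as [E'|E'].
  - injection E; intros; subst. f_equal. f_equal. ring.
  - exfalso. apply E'. injection E; intros; subst. repeat f_equal. ring.
  - exfalso. apply E. injection E'; intros; subst. repeat f_equal. ring.
  - ring.
Qed.

Lemma delta_shift2 (p : R) (k1 k2 k1' k2' : kind) (x y x' y' : R) :
  Cmul (RtoC (kap k2' * p - y')) (delta ((k1, x), (k2, y)) ((k1', x'), (k2', p + y'))) =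
  Cmul (RtoC ((kap k2 + 1) * p - y)) (delta ((k1, x), (k2, y - p)) ((k1', x'), (k2', y'))).
Proof.
  unfold delta.
  destruct (BB_eq_dec (k1', x', (k2', p + y')) (k1, x, (k2, y))) as [E|E],
    (BB_eq_dec (k1', x', (k2', y')) (k1, x, (k2, y - p))) as [E'|E'].
  - injection E; intros; subst. f_equal. f_equal. ring.
  - exfalso. apply E'. injection E; intros; subst. repeat f_equal. ring.
  - exfalso. apply E. injection E'; intros; subst. repeat f_equal. ring.
  - ring.
Qed.

(** * Reduction to real coefficient functions *)

(** The $L_p$ act with real structure constants, so real and imaginary parts can be treated as
    separate real cocycles. *)
Definition Cpart (i : bool) (z : C) : R := if i then Cim z else Cre z.

Lemma Cpart_eq (z w : C) : (forall i, Cpart i z = Cpart i w) -> z = w.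
Proof. intros E. apply C_eq; [apply (E false) | apply (E true)]. Qed.

Lemma Cpart_add (i : bool) (z w : C) : Cpart i (Cadd z w) = Cpart i z + Cpart i w.
Proof. destruct i; reflexivity. Qed.

Lemma Cpart_opp (i : bool) (z : C) : Cpart i (Copp z) = - Cpart i z.
Proof. destruct i; reflexivity. Qed.

Lemma Cpart_scal (i : bool) (r : R) (z : C) : Cpart i (Cmul (RtoC r) z) = r * Cpart i z.
Proof. destruct i; simpl; ring. Qed.

Definition coef (i : bool) (k1 k2 : kind) (v : Vvec) (x y : R) : R :=
  Cpart i (vev v ((k1, x), (k2, y))).

Lemma coef_act_L (i : bool) (k1 k2 : kind) (p : R) (v : Vvec) (x y : R) :
  coef i k1 k2 (act1 (KL, p) v) x y = wact (kap k1) (kap k2) p (coef i k1 k2 v) x y.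
Proof.
  unfold coef, wact. rewrite <- !Cpart_scal, <- Cpart_add. f_equal.
  rewrite !vev_ev, ev_act1, <- ev_lin. apply ev_ext.
  intros [[k1' x'] [k2' y']]. unfold tact. simpl fst; simpl snd.
  rewrite !mul_L, !cof_L, <- delta_shift1, <- delta_shift2.
  change (sgn (par (KL, p) && par (k1', x'))) with C1. unfold B. ring.
Qed.

Lemma coef_finsupp (i : bool) (k1 k2 : kind) (v : Vvec) : finsupp (coef i k1 k2 v).
Proof.
  exists (map (fun q => (snd (fst q), snd (snd q))) (map snd v)). intros x y H.
  apply in_map_iff. exists ((k1, x), (k2, y)). split; [reflexivity|].
  apply vev_support. intros E. apply H. unfold coef. rewrite E. now destruct i.
Qed.

(** * Derivations are inner *)

Lemma lev_single (e e' : B) : lev [(C1, e)] e' <> C0 -> e' = e.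
Proof. simpl. destruct (B_eq_dec e e'); congruence. Qed.

Lemma homL_single (Gam : R -> Prop) (s : R) (e : B) :
  validB Gam s e -> homL Gam s (par e) [(C1, e)].
Proof. intros He e' H. apply lev_single in H. now subst. Qed.

(** The derivation rule on $(L_p,X_r)$. As $L_p$ is even, the first sign is trivial and the second
    depends only on [pd] and the parity of $X_r$. *)
Lemma der_L (Gam : R -> Prop) (s : R) (pd : bool) (d : B -> Vvec) (p : R) (k : kind) (r : R)
    (phi : B * B -> C) :
  isDer Gam s pd d -> Gam p -> validB Gam s (k, r) ->
  Cmul (RtoC (kap k * p - r)) (ev phi (d (k, p + r))) =
  Cadd (ev phi (act1 (KL, p) (d (k, r))))
       (Copp (Cmul (sgn (pd && par (k, r))) (ev phi (act1 (k, r) (d (KL, p)))))).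
Proof.
  intros [_ Hd] Hp Hr.
  assert (E := ev_veq phi _ _ (Hd _ _ _ _ (homL_single Gam s (KL, p) Hp) (homL_single Gam s (k, r) Hr))).
  assert (L : ev phi (dext d (lbr [(C1, (KL, p))] [(C1, (k, r))])) =
    Cmul (RtoC (kap k * p - r)) (ev phi (d (k, p + r)))).
  { rewrite <- cof_L. destruct k; unfold cof; simpl; rewrite app_nil_r, ev_vscale; ring. }
  refine (eq_trans (eq_sym L) (eq_trans E _)). unfold vadd. rewrite ev_app, !ev_vscale.
  assert (D : forall e, dext d [(C1, e)] = vscale C1 (d e)) by (intros e; apply app_nil_r).
  rewrite !D. fold (act1 (KL, p) (vscale C1 (d (k, r)))).
  fold (act1 (k, r) (vscale C1 (d (KL, p)))). rewrite !ev_act1, !ev_vscale. change (par (KL, p)) with false.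
  rewrite andb_false_r. rewrite xorb_false_r, andb_comm. change (sgn false) with C1. unfold B. ring.
Qed.

Lemma Gam_multiple (Gam : R -> Prop) (g : R) (n : nat) :
  is_subgroup Gam -> Gam g -> Gam (INR n * g).
Proof.
  intros [H0 [Hadd _]] Hg. induction n as [|n IH].
  - simpl. now rewrite Rmult_0_l.
  - rewrite S_INR, Rmult_plus_distr_r, Rmult_1_l. now apply Hadd.
Qed.

Lemma validB_shift (Gam : R -> Prop) (s p : R) (k : kind) (r : R) :
  is_subgroup Gam -> Gam p -> validB Gam s (k, p + r) <-> validB Gam s (k, r).
Proof.
  intros [_ [Hadd Hopp]] Hp.
  assert (K : forall z, Gam (p + z) <-> Gam z).
  { intros z. split; [|now apply Hadd]. intros Hz.
    replace z with (- p + (p + z)) by ring. apply Hadd; [now apply Hopp | exact Hz]. }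
  destruct k; unfold validB; simpl; try apply K;
    replace (p + r - s) with (p + (r - s)) by ring; apply K.
Qed.

Lemma der_L_cocycle (Gam : R -> Prop) (s : R) (pd : bool) (d : B -> Vvec) (g : R)
    (i : bool) (k1 k2 : kind) :
  is_subgroup Gam -> Gam g -> isDer Gam s pd d ->
  wcocycle (kap k1) (kap k2) g (fun n => coef i k1 k2 (d (KL, INR n * g))).
Proof.
  intros HG Hg Hd n m x y.
  assert (E := der_L Gam s pd d (INR n * g) KL (INR m * g) (delta ((k1, x), (k2, y))) Hd
    (Gam_multiple Gam g n HG Hg) (Gam_multiple Gam g m HG Hg)).
  rewrite andb_false_r in E. change (sgn false) with C1 in E.
  replace (INR n * g + INR m * g) with (INR (n + m) * g) in E by (rewrite plus_INR; ring).
  rewrite <- !vev_ev in E. apply (f_equal (Cpart i)) in E.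
  rewrite Cpart_scal, Cpart_add, Cpart_opp in E.
  change C1 with (RtoC 1) in E. rewrite Cpart_scal in E.
  rewrite <- !coef_act_L. unfold coef. simpl kap in E. lra.
Qed.

Lemma finite_family (u : bool -> kind -> kind -> R -> R -> R) :
  (forall i k1 k2, finsupp (u i k1 k2)) ->
  exists v, forall i k1 k2 x y, coef i k1 k2 v x y = u i k1 k2 x y.
Proof.
  intros Hu.
  pose (l := fun i k1 k2 => proj1_sig (constructive_indefinite_description _ (Hu i k1 k2))).
  assert (Hl : forall i k1 k2 x y, u i k1 k2 x y <> 0 -> In (x, y) (l i k1 k2)).
  { intros i k1 k2. unfold l. apply proj2_sig. }
  pose (ks := [KL; KI; KG; KH]).
  assert (Hks : forall k, In k ks) by (intros []; simpl; tauto).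
  destruct (vvec_of_function
    (fun q => let '((k1, x), (k2, y)) := q in mkC (u false k1 k2 x y) (u true k1 k2 x y))
    (flat_map (fun i => flat_map (fun k1 => flat_map (fun k2 =>
       map (fun xy => ((k1, fst xy), (k2, snd xy))) (l i k1 k2)) ks) ks) [false; true]))
    as [v Hv].
  - intros [[k1 x] [k2 y]] H.
    assert (K : exists i, u i k1 k2 x y <> 0).
    { destruct (Req_dec_T (u false k1 k2 x y) 0) as [E|E]; [|now exists false].
      exists true. intros E'. apply H. now rewrite E, E'. }
    destruct K as [i Hi].
    apply in_flat_map. exists i. split; [destruct i; simpl; tauto|].
    apply in_flat_map. exists k1. split; [apply Hks|].
    apply in_flat_map. exists k2. split; [apply Hks|].
    apply in_map_iff. exists (x, y). split; [reflexivity | now apply Hl].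
  - exists v. intros i k1 k2 x y. unfold coef. rewrite Hv. now destruct i.
Qed.

Lemma der_inner_on_ray (Gam : R -> Prop) (s : R) (pd : bool) (d : B -> Vvec) (g : R) :
  is_subgroup Gam -> Gam g -> 0 < g -> isDer Gam s pd d ->
  exists a, homV Gam s pd a /\
    forall n, veq (d (KL, INR n * g)) (act1 (KL, INR n * g) a).
Proof.
  intros HG Hg Hg0 Hd.
  assert (H : forall i k1 k2, exists c : R -> R -> R, finsupp c /\
    (forall x y, c x y <> 0 -> exists n, coef i k1 k2 (d (KL, INR n * g)) x (y + INR n * g) <> 0) /\
    (forall n x y, coef i k1 k2 (d (KL, INR n * g)) x y = wact (kap k1) (kap k2) (INR n * g) c x y)).
  { intros i k1 k2.
    apply (cocycle_coboundary (kap k1) (kap k2) g (fun n => coef i k1 k2 (d (KL, INR n * g))));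
      [apply kap_ge | apply kap_ge | exact Hg0 | now apply der_L_cocycle with Gam s pd |].
    intros n. apply coef_finsupp. }
  pose (u := fun i k1 k2 => proj1_sig (constructive_indefinite_description _ (H i k1 k2))).
  assert (Hu : forall i k1 k2, finsupp (u i k1 k2) /\
    (forall x y, u i k1 k2 x y <> 0 ->
      exists n, coef i k1 k2 (d (KL, INR n * g)) x (y + INR n * g) <> 0) /\
    (forall n x y, coef i k1 k2 (d (KL, INR n * g)) x y =
      wact (kap k1) (kap k2) (INR n * g) (u i k1 k2) x y)).
  { intros i k1 k2. unfold u. apply proj2_sig. }
  destruct (finite_family u (fun i k1 k2 => proj1 (Hu i k1 k2))) as [a Ha].
  exists a. split.
  - intros [[k1 x] [k2 y]] Hne.
    assert (K : exists i, coef i k1 k2 a x y <> 0).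
    { destruct (Req_dec_T (coef false k1 k2 a x y) 0) as [E|E]; [|now exists false].
      destruct (Req_dec_T (coef true k1 k2 a x y) 0) as [E'|E']; [|now exists true].
      exfalso. apply Hne. now apply C_eq. }
    destruct K as [i Hi]. rewrite Ha in Hi.
    (* A nonzero coefficient of [a] is visible in some $d(L_{ng})$, displaced by [INR n * g] in the
       second slot. Validity survives that shift and parity depends only on the kinds, so [a]
       inherits homogeneity. *)
    destruct (proj1 (proj2 (Hu i k1 k2)) x y Hi) as [n Hn].
    destruct (proj1 Hd (KL, INR n * g) (Gam_multiple Gam g n HG Hg)
      ((k1, x), (k2, y + INR n * g))) as [[V1 V2] P].
    { intros E. apply Hn. unfold coef. rewrite E. now destruct i. }
    simpl fst in V1; simpl snd in V2. rewrite Rplus_comm in V2.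
    apply validB_shift in V2; [|exact HG | now apply Gam_multiple].
    split; [now split | exact P].
  - intros n [[k1 x] [k2 y]]. apply Cpart_eq. intros i.
    change (coef i k1 k2 (d (KL, INR n * g)) x y = coef i k1 k2 (act1 (KL, INR n * g) a) x y).
    rewrite coef_act_L, (proj2 (proj2 (Hu i k1 k2))). unfold wact. now rewrite !Ha.
Qed.

Lemma der_inner (Gam : R -> Prop) (s : R) (pd : bool) (d : B -> Vvec) :
  is_subgroup Gam -> (exists g, Gam g /\ g <> 0) -> isDer Gam s pd d ->
  exists a, homV Gam s pd a /\ forall e, validB Gam s e -> veq (d e) (inn pd a e).
Proof.
  intros HG [g' [Hg' Hne]] Hd.
  assert (Hg : exists g, Gam g /\ 0 < g).
  { destruct (Rlt_dec 0 g'); [now exists g'|]. exists (- g'). split; [|lra].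
    now apply HG. }
  destruct Hg as [g [Hg Hg0]].
  destruct (der_inner_on_ray Gam s pd d g HG Hg Hg0 Hd) as [a [Ha Hray]].
  exists a. split; [exact Ha|].
  intros [k r] He [[k1 x] [k2 y]]. apply Cpart_eq. intros i.
  pose (diff := fun e => vadd (d e) (vscale (Copp C1) (inn pd a e))).
  (* [diff] commutes with each $L_p$, $p=mg$: in the derivation rule $d(L_p)$ may be replaced by
     $L_p\circ a$, and the module identity for [a] cancels the resulting term. *)
  assert (Hdiff : forall n m phi,
    Cmul (RtoC (kap k * (INR m * g) - (r + INR n * g))) (ev phi (diff (k, r + INR (n + m) * g))) =
    ev phi (act1 (KL, INR m * g) (diff (k, r + INR n * g)))).
  { intros n m phi. set (p := INR m * g). set (t := r + INR n * g).
    replace (r + INR (n + m) * g) with (p + t) by (unfold p, t; rewrite plus_INR; ring).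
    assert (Ht : validB Gam s (k, t)).
    { unfold t. rewrite Rplus_comm. apply validB_shift; [exact HG | now apply Gam_multiple | exact He]. }
    assert (E := der_L Gam s pd d p k t phi Hd (Gam_multiple Gam g m HG Hg) Ht).
    assert (E' := ev_veq phi _ _ (act1_veq (k, t) _ _ (Hray m))). fold p in E'.
    rewrite E' in E.
    assert (J := act1_jacobi_L phi p k t a).
    unfold diff, vadd, inn.
    fold (act1 (k, t) a). fold (act1 (k, p + t) a). rewrite ev_act1, !ev_app, !ev_vscale, <- !ev_act1.
    replace (par (k, p + t)) with (par (k, t)) by (destruct k; reflexivity).
    set (sg := sgn (pd && par (k, t))) in *.
    transitivity (Cadd (Cmul (RtoC (kap k * p - t)) (ev phi (d (k, p + t))))
      (Cmul (Copp sg) (Cmul (RtoC (kap k * p - t)) (ev phi (act1 (k, p + t) a))))); [ring|].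
    rewrite E, J. ring. }
  (* The translates [r + INR n * g] supply the family for any kind and any [r]; its member [n = 0]
     is [diff] at [(k, r)] itself. *)
  assert (Z : coef i k1 k2 (diff (k, r + INR 0 * g)) x y = 0).
  { apply (equivariant_vanish (kap k) (kap k1) (kap k2) g r
      (fun n => coef i k1 k2 (diff (k, r + INR n * g))));
      [apply kap_ge | apply kap_ge | apply kap_ge | exact Hg0 | apply coef_finsupp |].
    intros n m x' y'. rewrite <- coef_act_L. unfold coef.
    rewrite <- Cpart_scal, !vev_ev. f_equal. apply Hdiff. }
  simpl INR in Z. replace (r + 0 * g) with r in Z by ring.
  unfold coef, diff, vadd in Z.
  rewrite vev_ev, ev_app, ev_vscale, <- !vev_ev in Z.
  replace (Cmul (Copp C1) (vev (inn pd a (k, r)) (k1, x, (k2, y))))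
    with (Copp (vev (inn pd a (k, r)) (k1, x, (k2, y)))) in Z by ring.
  rewrite Cpart_add, Cpart_opp in Z. now apply Rminus_diag_uniq.
Qed.

Theorem mainTheorem1 :
  forall (Gam : R -> Prop) (s : R),
    is_subgroup Gam ->
    (exists g, Gam g /\ g <> 0) ->
    Gam (2 * s) ->
    forall d0 d1 : B -> Vvec,
      isDer Gam s false d0 ->
      isDer Gam s true d1 ->
      exists a0 a1 : Vvec,
        homV Gam s false a0 /\ homV Gam s true a1 /\
        forall e : B, validB Gam s e ->
          veq (vadd (d0 e) (d1 e)) (vadd (inn false a0 e) (inn true a1 e)).
Proof.
  intros Gam s HG Hne _ d0 d1 H0 H1.
  destruct (der_inner Gam s false d0 HG Hne H0) as [a0 [Ha0 E0]].
  destruct (der_inner Gam s true d1 HG Hne H1) as [a1 [Ha1 E1]].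
  exists a0, a1. split; [exact Ha0|]. split; [exact Ha1|].
  intros e He p. unfold vadd. rewrite !vev_ev, !ev_app, <- !vev_ev.
  now rewrite (E0 e He p), (E1 e He p).
Qed.
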